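(* Let $n \ge 8$ be an integer divisible by $4$, and let $G = G(n, n/2)$ be the graph with the $2n$ distinct vertices $u_0,\dots,u_{n-1},v_0,\dots,v_{n-1}$ and with edges $u_iu_{i+1}$, $u_iv_i$, $v_iv_{i+n/2}$ for $0\le i\le n-1$ (subscripts modulo $n$). Let $m$ be the minimum $k\ge 0$ such that $G$ has a $k$-Unbounded Hamiltonian Cycle. Then $m = 2$ if $n = 8$, and $2 \le m \le 3$ if $n > 8$.
   Context: All graphs are finite, simple and undirected. A path here means a finite walk, i.e. a finite sequence of vertices $(x_1,\dots,x_\ell)$ with consecutive vertices adjacent; vertices and edges may repeat. A vertex is bounded in such a path if it appears exactly once in the sequence and unbounded if it appears more than once. A $k$-Unbounded Hamiltonian Path is a path in which every vertex of the graph appears and exactly $k$ vertices are unbounded. A $k$-Unbounded Hamiltonian Cycle is a $k$-Unbounded Hamiltonian Path whose first and last vertices $x_1$, $x_\ell$ are adjacent. The edges $v_iv_{i+n/2}$ for $i$ and $i+n/2$ coincide, so each $v_i$ has degree $2$ and each $u_i$ has degree $3$. *)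

(* Defs.v *)
From mathcomp Require Import all_boot.

Set Implicit Arguments.
Unset Strict Implicit.
Unset Printing Implicit Defensive.

(* A graph is given by its adjacency relation [e] on a finite vertex type [T];
   the walk (x_1, ..., x_l) is represented by its first vertex [x] together
   with the sequence [p] of the remaining ones, so that l >= 1. *)

Definition unbounded (T : finType) (s : seq T) : {set T} :=
  [set y | 1 < count_mem y s].

Definition unbounded_ham_path (T : finType) (e : rel T) (k : nat)
    (x : T) (p : seq T) : Prop :=
  [/\ path e x p,
      forall y : T, y \in x :: p
    & #|unbounded (x :: p)| = k].

Definition unbounded_ham_cycle (T : finType) (e : rel T) (k : nat)
    (x : T) (p : seq T) : Prop :=
  unbounded_ham_path e k x p /\ e x (last x p).

Definition has_unbounded_ham_cycle (T : finType) (e : rel T) (k : nat) : Prop :=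
  exists (x : T) (p : seq T), unbounded_ham_cycle e k x p.

Definition is_minimum (P : nat -> Prop) (m : nat) : Prop :=
  P m /\ forall k, P k -> m <= k.

(* [inl i] is u_i and [inr i] is v_i. *)
Definition gp_vertex (n : nat) : finType := ('I_n + 'I_n)%type.

Definition gp_arc (n d : nat) : rel (gp_vertex n) := fun x y =>
  match x, y with
  | inl i, inl j => (j : nat) == (i + 1) %% n
  | inl i, inr j => i == j
  | inr i, inr j => (j : nat) == (i + d) %% n
  | inr _, inl _ => false
  end.

Definition gp_adj (n d : nat) : rel (gp_vertex n) := fun x y =>
  gp_arc d x y || gp_arc d y x.

Lemma gp_adj_sym n d : symmetric (@gp_adj n d).
Proof. by move=> x y; rewrite /gp_adj orbC. Qed.

Lemma gp_adj_irr n d : 1 < n -> 0 < d < n -> irreflexive (@gp_adj n d).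
Proof.
move=> n1 /andP[d0 dn].
have shift (i : 'I_n) c : 0 < c < n -> ((i : nat) == (i + c) %% n) = false.
  move=> /andP[c0 cn]; apply/eqP => E.
  have /eqP : i + 0 = i + c %[mod n] by rewrite addn0 -E modn_small.
  by rewrite eqn_modDl mod0n modn_small // eq_sym -(negbK (c == 0)) -lt0n c0.
by case=> i; rewrite /gp_adj /gp_arc orbb shift ?n1 ?d0.
Qed.

(* Main.v *)
Require Import Defs.
From mathcomp Require Import all_boot zify.
From Stdlib Require Import Classical.

(* Write h = n/2. The graph is a cycle u_0 ... u_{n-1} whose antipodal pairs are
   joined by rungs u_i v_i v_{i+h} u_{i+h}.

   Lower bound. A closed spanning walk gives each edge a multiplicity; the
   multiplicities around y sum to twice the number of occurrences of y, and the
   edges of positive multiplicity connect the graph. If at most one vertex is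
   repeated, this forces every rung edge u_i v_i to have multiplicity 1, so the
   outer edges alternate between multiplicities 0 and 1. As h is even, two
   consecutive rungs joined by outer edges at both ends then form a component
   with 8 < 2n vertices.

   Upper bound. Going up and down the rungs 0, 1, ..., h-1 in turn is a
   Hamiltonian path from u_0 to u_{h-1}, and u_h, v_h, v_0 close it up. For n = 8
   there is a Hamiltonian path whose ends are at distance 3. *)

Set Implicit Arguments.
Unset Strict Implicit.
Unset Printing Implicit Defensive.

(** * Edge multiplicities of a closed walk *)

Section EdgeMultiplicity.

Variables (T : finType) (e : rel T).
Hypothesis e_sym : symmetric e.

Lemma sum_count_pair (A : seq (T * T)) (a : T) :
  \sum_b count_mem (a, b) A = count_mem a (unzip1 A).
Proof.
elim: A => [|[x y] A IH] /=; first by rewrite big1.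
rewrite big_split /= IH; congr (_ + _).
rewrite (bigD1 y) //= big1 => [|b /negPf nby].
  by rewrite addn0 xpair_eqE eqxx andbT.
by rewrite xpair_eqE [y == b]eq_sym nby andbF.
Qed.

Lemma sum_count_swap (A : seq (T * T)) (a : T) :
  \sum_b count_mem (b, a) A = count_mem a (unzip2 A).
Proof.
elim: A => [|[x y] A IH] /=; first by rewrite big1.
rewrite big_split /= IH; congr (_ + _).
rewrite (bigD1 x) //= big1 => [|b /negPf nbx].
  by rewrite addn0 xpair_eqE eqxx.
by rewrite xpair_eqE [x == b]eq_sym nbx.
Qed.

Definition cyc_arcs (x : T) (p : seq T) : seq (T * T) :=
  zip (x :: p) (rcons p x).

Definition edge_mult (x : T) (p : seq T) (a b : T) : nat :=
  count_mem (a, b) (cyc_arcs x p) + count_mem (b, a) (cyc_arcs x p).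

Lemma edge_multC x p a b : edge_mult x p a b = edge_mult x p b a.
Proof. exact: addnC. Qed.

(** In the closed walk every occurrence of [a] is the tail of one arc and the head of one arc. *)
Lemma sum_edge_mult x p a :
  \sum_b edge_mult x p a b = 2 * count_mem a (x :: p).
Proof.
rewrite big_split /= sum_count_pair sum_count_swap /cyc_arcs.
rewrite unzip1_zip ?size_rcons // unzip2_zip ?size_rcons //.
by rewrite -cats1 count_cat /=; lia.
Qed.

Lemma path_zip (r : rel T) x q :
  path r x q = all (fun ab => r ab.1 ab.2) (zip (x :: q) q).
Proof. by elim: q x => //= y q IH x; rewrite IH. Qed.

(** [zip] drops the extra last entry; the right-hand side has the shape required by [path_zip]. *)
Lemma cyc_arcsE x p : cyc_arcs x p = zip (x :: rcons p x) (rcons p x).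
Proof.
rewrite /cyc_arcs; suff H z : zip (z :: p) (rcons p x) =
  zip (z :: rcons p x) (rcons p x) by apply: H.
by elim: p z => //= y p IH z; rewrite -IH.
Qed.

Lemma edge_mult_adj x p a b :
  path e x p -> e x (last x p) -> 0 < edge_mult x p a b -> e a b.
Proof.
move=> pth clos; rewrite addn_gt0 -!has_count !has_pred1 cyc_arcsE.
have : path e x (rcons p x) by rewrite rcons_path pth e_sym.
by rewrite path_zip => /allP H /orP[] /H //=; rewrite e_sym.
Qed.

(** The closed walk itself joins any two vertices by edges of positive multiplicity. *)
Lemma edge_mult_connected x p (S : seq T) a :
  (forall y, y \in x :: p) -> a \in S ->
  (forall y z, y \in S -> 0 < edge_mult x p y z -> z \in S) ->
  forall b, b \in S.
Proof.
move=> cov aS closS b; pose E y z := 0 < edge_mult x p y z.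
have cycE : cycle E (x :: p).
  rewrite /= path_zip -cyc_arcsE; apply/allP => -[y z] yz /=.
  by rewrite /E addn_gt0 -has_count has_pred1 yz.
have conn := connect_cycle cycE (cov a) (cov b).
suff clE : closed E S by rewrite -(closed_connect clE conn).
move=> y z Eyz; apply/idP/idP => [/closS|/closS]; apply=> //.
by rewrite edge_multC.
Qed.

Lemma sum_support (f : T -> nat) (l : seq T) :
  uniq l -> (forall b, 0 < f b -> b \in l) -> \sum_b f b = \sum_(b <- l) f b.
Proof.
move=> ul fl; rewrite [RHS]big_uniq //= [LHS](bigID [in l]) /=.
rewrite [X in _ + X]big1 ?addn0 // => b; case: (posnP (f b)) => // /fl.
by move=> ->.
Qed.

(** By the cardinality condition [x :: p] visits each vertex exactly once, so the repeated vertices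
    are precisely those of [t]. *)
Lemma has_unbounded_ham_cycle_cat x p t :
  #|T| = size (x :: p) -> (forall y, y \in x :: p) -> uniq t ->
  path e x (p ++ t) -> e x (last x (p ++ t)) ->
  has_unbounded_ham_cycle e (size t).
Proof.
move=> szp cov ut pth clos; exists x, (p ++ t); split=> //.
have up : uniq (x :: p).
  apply: (@leq_size_uniq _ (enum T)); rewrite ?enum_uniq //.
  by rewrite -cardE szp.
split=> // [y|]; first by rewrite -cat_cons mem_cat cov.
rewrite -(card_uniqP ut) /unbounded; apply: eq_card => y.
rewrite inE -cat_cons count_cat (count_uniq_mem y up) (count_uniq_mem y ut).
by rewrite cov; case: (y \in t).
Qed.

Lemma at_most_one_unbounded (s : seq T) (y0 : T) :
  (forall y, y \in s) -> #|unbounded s| <= 1 ->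
  exists w, forall y, y != w -> count_mem y s = 1.
Proof.
move=> cov le1.
have one w : (forall y, y \in unbounded s -> y = w) ->
    forall y, y != w -> count_mem y s = 1.
  move=> Hw y yw; have := cov y; rewrite -has_pred1 has_count => c1.
  apply/eqP; rewrite eqn_leq c1 andbT leqNgt; apply: contra yw => c2.
  by apply/eqP/Hw; rewrite inE.
case: (set_0Vmem (unbounded s)) => [E0|[w wU]].
  (* Nothing is repeated, so any vertex can serve as the exceptional one. *)
  by exists y0; apply: one => y; rewrite E0 inE.
by exists w; apply: one => y; rewrite (card_le1P le1 _ wU) => /eqP.
Qed.

End EdgeMultiplicity.

(* At a rung u v v' u', the variables stand for the multiplicities of the edges
   uv, u'v', vv' and of the outer edges at u and at u', and for the numbers of
   occurrences of u, u', v, v'. The hypotheses ending in False exclude small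
   components. *)
Lemma rung_mult_eq1 r r' s o1 o2 o1' o2' cu cu' cv cv' :
  r + s = 2 * cv -> r' + s = 2 * cv' ->
  o1 + o2 + r = 2 * cu -> o1' + o2' + r' = 2 * cu' ->
  (r = 0 -> r' = 0 -> False) ->
  (o1 = 0 -> o2 = 0 -> s = 0 -> False) ->
  (o1' = 0 -> o2' = 0 -> s = 0 -> False) ->
  (o1 = 0 -> o2 = 0 -> r' = 0 -> False) ->
  (o1' = 0 -> o2' = 0 -> r = 0 -> False) ->
  cu = 1 \/ cu' = 1 -> cv = 1 \/ cv' = 1 ->
  cu = 1 \/ cv = 1 -> cu = 1 \/ cv' = 1 ->
  cu' = 1 \/ cv = 1 -> cu' = 1 \/ cv' = 1 ->
  r = 1.
Proof.
move=> H1 H2 H3 H4 F1 F2 F3 F4 F5.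
case: (eqVneq cu 1) => [E1|/eqP N1]; last first.
  move=> [//|E1] _ [//|E2] [//|E3] _ _; subst; lia.
case: (eqVneq cu' 1) => [E2|/eqP N2]; last first.
  move=> _ _ _ _ [//|E3] [//|E4]; subst; lia.
case: (eqVneq cv 1) => [E3|/eqP N3]; last first.
  move=> _ [//|E4] _ _ _ _; subst; lia.
subst => *; lia.
Qed.

(** * The graph and its neighbourhoods *)

Section Prism.

Variables (n h : nat).
Hypotheses (n_gt0 : 0 < n) (n_double : n = h + h).

(** Indices are arbitrary naturals reduced modulo [n], so that [i.+1] and [i + h] need no
    wrap-around cases. *)
Definition U (i : nat) : gp_vertex n := inl (Ordinal (ltn_pmod i n_gt0)).
Definition V (i : nat) : gp_vertex n := inr (Ordinal (ltn_pmod i n_gt0)).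

Lemma eqUU i j : (U i == U j) = (i == j %[mod n]).
Proof. by []. Qed.

Lemma eqVV i j : (V i == V j) = (i == j %[mod n]).
Proof. by []. Qed.

Lemma eqUV i j : (U i == V j) = false.
Proof. by []. Qed.

Lemma eqVU i j : (V i == U j) = false.
Proof. by []. Qed.

Lemma eq_modD i a b : a < n -> b < n -> (i + a == i + b %[mod n]) = (a == b).
Proof. by move=> an bn; rewrite eqn_modDl !modn_small. Qed.

Lemma neqU i j : i < j < i + n -> U i != U j.
Proof.
move=> /andP[ij jn]; rewrite eqUU -(subnKC (ltnW ij)) -{1}(addn0 i) eq_modD //.
all: lia.
Qed.

Lemma vertexP (y : gp_vertex n) :
  (exists2 i, i < n & y = U i) \/ (exists2 i, i < n & y = V i).
Proof.
case: y => i; [left|right]; exists i => //; congr (_ _); apply: val_inj;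
  by rewrite /= modn_small.
Qed.

Lemma Umod i j : i = j %[mod n] -> U i = U j.
Proof. by move=> E; apply/eqP; rewrite eqUU; apply/eqP. Qed.

Lemma Vmod i j : i = j %[mod n] -> V i = V j.
Proof. by move=> E; apply/eqP; rewrite eqVV; apply/eqP. Qed.

Lemma Vhh i : V (i + h + h) = V i.
Proof. by apply: Vmod; rewrite -addnA -n_double modnDr. Qed.

Local Notation e := (@gp_adj n h).

Lemma adjUU i : e (U i) (U i.+1).
Proof. by rewrite /gp_adj /= modnDml addn1 eqxx. Qed.

Lemma adjUV i : e (U i) (V i).
Proof. by rewrite /gp_adj /= eqxx. Qed.

Lemma adjVV i : e (V i) (V (i + h)).
Proof. by rewrite /gp_adj /= modnDml eqxx. Qed.

Lemma adjVU i : e (V i) (U i).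
Proof. by rewrite gp_adj_sym adjUV. Qed.

Lemma adjVV' i : e (V (i + h)) (V i).
Proof. by rewrite gp_adj_sym adjVV. Qed.

(** Centring at [i.+1] avoids a predecessor modulo [n]. *)
Lemma nbrU i b : e (U i.+1) b -> b \in [:: U i; U i.+2; V i.+1].
Proof.
case: (vertexP b) => -[j _ ->]; rewrite !inE ?eqUU ?eqVV ?eqUV ?eqVU ?orbF /=.
- rewrite /gp_adj /= !modnDml !addn1 => /orP[->|]; first by rewrite orbT.
  by rewrite -(addn1 i) -(addn1 j) eqn_modDr eq_sym => ->.
- by rewrite /gp_adj /= orbF => /eqP[->].
Qed.

Lemma nbrV i b : e (V i) b -> b \in [:: U i; V (i + h)].
Proof.
case: (vertexP b) => -[j _ ->]; rewrite !inE ?eqUU ?eqVV ?eqUV ?eqVU ?orbF /=.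
- by rewrite /gp_adj /= => /eqP[->].
- rewrite /gp_adj /= !modnDml => /orP[//|/eqP E].
  by rewrite -modnDml E modnDml -addnA -n_double modnDr.
Qed.

Hypotheses (h_even : ~~ odd h) (h_ge4 : 4 <= h).

(** * Lower bound: two repeated vertices are necessary *)

Section LowerBound.

Variables (x : gp_vertex n) (p : seq (gp_vertex n)).
Hypotheses (cov : forall y, y \in x :: p) (pth : path e x p)
  (clos : e x (last x p)).

Local Notation D := (edge_mult x p).
Local Notation c y := (count_mem y (x :: p)).

Let Dadj a b : 0 < D a b -> e a b.
Proof. exact: (edge_mult_adj (@gp_adj_sym n h) pth clos). Qed.

Lemma degU i :
  D (U i) (U i.+1) + D (U i.+1) (U i.+2) + D (U i.+1) (V i.+1)
  = 2 * c (U i.+1).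
Proof.
rewrite -sum_edge_mult (@sum_support _ _ [:: U i; U i.+2; V i.+1]).
- by rewrite !big_cons big_nil (edge_multC x p (U i.+1) (U i)) addn0 addnA.
- by rewrite /= !inE !eqUV !orbF !andbT neqU //; lia.
- by move=> b /Dadj /nbrU.
Qed.

Lemma degV i : D (U i) (V i) + D (V i) (V (i + h)) = 2 * c (V i).
Proof.
rewrite -sum_edge_mult (@sum_support _ _ [:: U i; V (i + h)]) //.
- by rewrite !big_cons big_nil (edge_multC x p (V i) (U i)) addn0.
- by move=> b /Dadj /nbrV.
Qed.

Lemma not_closed (S : seq (gp_vertex n)) a b :
  a \in S -> b \notin S ->
  ~ (forall y z, y \in S -> 0 < D y z -> z \in S).
Proof. by move=> aS /negP bS /(edge_mult_connected cov aS) /(_ b). Qed.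

(** No edge of positive multiplicity would leave the two inner vertices of the rung. This and the
    next two lemmas supply the hypotheses ending in [False] of [rung_mult_eq1]. *)
Lemma comp_VV i : D (U i) (V i) = 0 -> D (U (i + h)) (V (i + h)) = 0 -> False.
Proof.
move=> r0 r1; apply: (@not_closed [:: V i; V (i + h)] (V i) (U i)).
- by rewrite !inE eqxx.
- by rewrite !inE.
move=> y z; rewrite !inE => /orP[]/eqP-> Dz; have /nbrV := Dadj Dz;
  rewrite !inE => /orP[]/eqP E; move: Dz; rewrite E ?Vhh ?eqxx ?orbT //;
  by rewrite edge_multC ?r0 ?r1.
Qed.

Lemma comp_UV i : D (U i) (U i.+1) = 0 -> D (U i.+1) (U i.+2) = 0 ->
  D (V i.+1) (V (i.+1 + h)) = 0 -> False.
Proof.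
move=> o0 o1 s0; apply: (@not_closed [:: U i.+1; V i.+1] (V i.+1) (U i)).
- by rewrite !inE eqxx orbT.
- by rewrite !inE eqUV orbF neqU //; lia.
move=> y z; rewrite !inE => /orP[]/eqP-> Dz.
  have /nbrU := Dadj Dz; rewrite !inE => /or3P[]/eqP E; move: Dz;
    rewrite E ?eqxx ?orbT // ?o1 //; by rewrite edge_multC o0.
have /nbrV := Dadj Dz; rewrite !inE => /orP[]/eqP E; move: Dz;
  by rewrite E ?eqxx ?s0.
Qed.

Lemma comp_UVV i : D (U i) (U i.+1) = 0 -> D (U i.+1) (U i.+2) = 0 ->
  D (U (i.+1 + h)) (V (i.+1 + h)) = 0 -> False.
Proof.
move=> o0 o1 r0.
apply: (@not_closed [:: U i.+1; V i.+1; V (i.+1 + h)] (V i.+1) (U i)).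
- by rewrite !inE eqxx orbT.
- by rewrite !inE !eqUV !orbF neqU //; lia.
move=> y z; rewrite !inE => /or3P[]/eqP-> Dz.
- have /nbrU := Dadj Dz; rewrite !inE => /or3P[]/eqP E; move: Dz;
    rewrite E ?eqxx ?orbT // ?o1 //; by rewrite edge_multC o0.
- have /nbrV := Dadj Dz; rewrite !inE => /orP[]/eqP E; move: Dz;
    by rewrite E ?eqxx ?orbT.
- have /nbrV := Dadj Dz; rewrite !inE => /orP[]/eqP E; move: Dz;
    rewrite E ?Vhh ?eqxx ?orbT //; by rewrite edge_multC r0.
Qed.

Variable w : gp_vertex n.
Hypothesis c1 : forall y, y != w -> c y = 1.

Lemma c1_or a b : a != b -> c a = 1 \/ c b = 1.
Proof.
move=> ab; case: (eqVneq a w) => [aw|/c1]; last by left.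
by right; apply: c1; rewrite -aw eq_sym.
Qed.

Lemma rung_once i : D (U i.+1) (V i.+1) = 1.
Proof.
have V1 := degV i.+1; have V2 := degV (i.+1 + h).
have U2 := degU (i + h).
have F1 := @comp_VV i.+1; have F3 := @comp_UV (i + h).
have F5 := @comp_UVV (i + h).
(* Since [n = h + h], the rung seen from [i.+1 + h] is the rung at [i.+1] read backwards. *)
have Uh : U (i.+1 + h + h) = U i.+1.
  by apply: Umod; rewrite -addnA -n_double modnDr.
rewrite -!addSn !Vhh in V2 U2 F3 F5; rewrite Uh in F5.
rewrite (edge_multC x p (V (i.+1 + h))) in V2 F3.
have neh : (i.+1 == i.+1 + h %[mod n]) = false.
  by rewrite -{1}(addn0 i.+1) eq_modD //; lia.
apply: (rung_mult_eq1 V1 V2 (degU i) U2 F1 (@comp_UV i) F3 (@comp_UVV i) F5);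
  by apply: c1_or; rewrite // ?eqUU ?eqVV neh.
Qed.

(** The four given edges are the only ones leaving the rungs at [i.+1] and [i.+2], and [U i] lies on
    neither rung. *)
Lemma comp_8 i :
  D (U i) (U i.+1) = 0 -> D (U i.+2) (U i.+3) = 0 ->
  D (U (i + h)) (U (i.+1 + h)) = 0 ->
  D (U (i.+2 + h)) (U (i.+3 + h)) = 0 -> False.
Proof.
move=> o0 o2 o0h o2h.
apply: (@not_closed [:: U i.+1; U i.+2; V i.+1; V i.+2; U (i.+1 + h);
  U (i.+2 + h); V (i.+1 + h); V (i.+2 + h)] (U i.+1) (U i)).
- by rewrite !inE eqxx.
- by rewrite !inE !eqUV !orbF !negb_or !neqU //; lia.
have nU j z : 0 < D (U (j.+1 + h)) z ->
    z \in [:: U (j + h); U (j.+2 + h); V (j.+1 + h)].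
  by move/Dadj/nbrU.
move=> y z; rewrite !inE.
case/or4P=> [|||/or4P[|||/orP[]]] /eqP-> Dz;
  [have := nbrU (Dadj Dz)|have := nbrU (Dadj Dz)
  |have := nbrV (Dadj Dz)|have := nbrV (Dadj Dz)
  |have := nU _ _ Dz|have := nU _ _ Dz
  |have := nbrV (Dadj Dz)|have := nbrV (Dadj Dz)];
  rewrite ?Vhh !inE; do ?case/orP; move=> /eqP E; move: Dz;
  rewrite E ?eqxx ?orbT //.
all: by rewrite ?o2 ?o2h // edge_multC ?o0 ?o0h.
Qed.

Lemma at_most_one_unbounded_absurd : False.
Proof.
(* Numbering starts at the index of [w], so that the alternation of outer multiplicities can fail
   only at [U t]. *)
have [t tw] : exists t, forall k, 0 < k < n -> U (t + k) != w.
  case: (vertexP w) => -[i _ ->]; exists i => k /andP[k0 kn] //.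
  by rewrite eqUU -{2}(addn0 i) eq_modD // -lt0n.
pose o k := D (U (t + k)) (U (t + k).+1).
have oS k : k.+1 < n -> o k + o k.+1 = 1.
  move=> kn; have := degU (t + k); rewrite rung_once c1 -?addnS ?tw //.
  by rewrite /o -!addnS; lia.
have o2 k j : o k = 0 -> k + j.*2 < n -> o (k + j.*2) = 0.
  move=> ok0; elim: j => [|j IH]; first by rewrite addn0.
  rewrite doubleS !addnS => kn.
  have := oS (k + j.*2); have := oS (k + j.*2).+1; lia.
(* The zero chosen here recurs at every even distance, in particular at distance [h]. The largest
   index used is [k + h + 2], at most [h + 3], which is below [n] because [4 <= h]. *)
have [k kle1 ok0] : exists2 k, k <= 1 & o k = 0.
  by have := oS 0; case: (posnP (o 0)) => ?; [exists 0|exists 1]; lia.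
have hE : h = h./2.*2 by rewrite -[LHS]odd_double_half (negPf h_even).
have ok2 : o k.+2 = 0 by have := oS k; have := oS k.+1; lia.
have okh : o (k + h) = 0 by rewrite hE o2 // -hE; lia.
have okh2 : o (k + h).+2 = 0.
  by have := oS (k + h); have := oS (k + h).+1; lia.
move: ok0 ok2 okh okh2; rewrite /o !addnS !addnA -!addSn; exact: comp_8.
Qed.

End LowerBound.

Lemma has_unbounded_ham_cycle_ge2 k :
  has_unbounded_ham_cycle e k -> 2 <= k.
Proof.
case=> x [p [[pth cov <-] clos]]; rewrite leqNgt; apply/negP => le1.
have [w c1] := at_most_one_unbounded x cov le1.
exact: (at_most_one_unbounded_absurd cov pth clos c1).
Qed.

(** * Upper bound: explicit walks *)

(** Traversing one rung changes sides, so rungs are taken in pairs: the walk returns to the initial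
    side, next to [U k.+1.*2]. *)
Definition rung_pair (k : nat) : seq (gp_vertex n) :=
  [:: U k.*2; V k.*2; V (k.*2 + h); U (k.*2 + h);
      U (k.*2.+1 + h); V (k.*2.+1 + h); V k.*2.+1; U k.*2.+1].

Definition zigzag (k m : nat) : seq (gp_vertex n) :=
  flatten [seq rung_pair j | j <- iota k m].

Lemma zigzagS k m : zigzag k m.+1 = rung_pair k ++ zigzag k.+1 m.
Proof. by []. Qed.

Lemma path_zigzag k m y : e y (U k.*2) -> path e y (zigzag k m).
Proof.
elim: m k y => // m IH k y ey; rewrite zigzagS /= ey.
by rewrite IH ?doubleS ?adjUU // !(adjUV, adjVU, adjVV, adjVV').
Qed.

Lemma last_zigzag k m y : last y (zigzag k m.+1) = U (k + m).*2.+1.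
Proof.
elim: m k y => [|m IH] k y; first by rewrite addn0.
by rewrite zigzagS last_cat IH addSnnS.
Qed.

Lemma size_zigzag k m : size (zigzag k m) = 8 * m.
Proof.
elim: m k => // m IH k.
by rewrite zigzagS size_cat IH mulnS.
Qed.

Lemma mem_zigzag y : y \in zigzag 0 h./2.
Proof.
have hE : h = h./2.*2 by rewrite -[LHS]odd_double_half (negPf h_even).
suff H i : i < h ->
    [/\ U i \in zigzag 0 h./2, V i \in zigzag 0 h./2,
        U (i + h) \in zigzag 0 h./2 & V (i + h) \in zigzag 0 h./2].
  case: (vertexP y) => -[i ltin ->]; case: (ltnP i h) => [/H[]//|leh];
    rewrite -(subnK leh); have /H[]// : i - h < h by lia.
move=> lih; have iE := odd_double_half i.
have i2 : i./2 \in iota 0 h./2 by rewrite mem_iota; lia.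
have inz z : z \in rung_pair i./2 -> z \in zigzag 0 h./2.
  by move=> zr; apply/flattenP; exists (rung_pair i./2); rewrite ?map_f.
split; apply: inz; rewrite -{1}iE /rung_pair; case: (odd i);
  by rewrite ?add0n ?add1n !inE eqxx ?orbT.
Qed.

Lemma has_unbounded_ham_cycle3 : has_unbounded_ham_cycle e 3.
Proof.
have hE : h = h./2.*2 by rewrite -[LHS]odd_double_half (negPf h_even).
have [hltn /negPf hneq0] : h < n /\ h != 0 by lia.
have [m hm] : exists m, h./2 = m.+1 by exists h./2.-1; lia.
have := mem_zigzag; have := size_zigzag 0 h./2.
(* [V 0] is only an auxiliary neighbour preceding the actual start [U 0]. *)
have := @path_zigzag 0 h./2 (V 0); have := last_zigzag 0 m (V 0).
rewrite hm zigzagS /=.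
set p := [:: V 0, _ & _] => lastp pthp szp cov.
(* The Hamiltonian path ends at [U h.-1]; the repeated vertices lead from there to [V 0], a
   neighbour of [U 0]. *)
apply: (@has_unbounded_ham_cycle_cat _ e (U 0) p
  [:: U h; V h; V 0]) => //.
- rewrite card_sum !card_ord (szp : size (U 0 :: p) = 8 * m.+1).
  by move: n_double hE hm; clear; lia.
- by rewrite /= !inE eqVV mod0n modn_small // hneq0.
- have pth : path e (U 0) p by have /pthp/andP[] := adjVU 0.
  have {}lastp : last (U 0) p = U m.*2.+1 by exact: lastp.
  rewrite cat_path pth lastp /=.
  have hS : m.*2.+2 = h by rewrite [RHS]hE hm.
  have := adjUU m.*2.+1; rewrite hS => ->.
  by rewrite adjUV (adjVV' 0).
- by rewrite last_cat /= adjUV.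
Qed.

End Prism.

Lemma has_unbounded_ham_cycle2_8 : has_unbounded_ham_cycle (@gp_adj 8 4) 2.
Proof.
have n8 : 0 < 8 by [].
pose u := U n8; pose v := V n8.
(* The Hamiltonian path ends at [v 2], and repeating [u 2] and [u 1] leads back to a neighbour of
   [u 0]. *)
apply: (@has_unbounded_ham_cycle_cat _ _ (u 0)
  [:: v 0; v 4; u 4; u 5; v 5; v 1; u 1; u 2; u 3; v 3; v 7; u 7; u 6; v 6; v 2]
  [:: u 2; u 1]) => //.
- by rewrite card_sum !card_ord.
- by move=> y; case: (vertexP n8 y) => -[i lti ->]; do 8!case: i lti => [|i] // lti.
Qed.

Theorem mainTheorem1 (n : nat) (hn : 8 <= n) (h4 : 4 %| n) :
  exists m : nat,
    is_minimum (has_unbounded_ham_cycle (@gp_adj n (n %/ 2))) m /\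
    (n = 8 -> m = 2) /\
    (8 < n -> 2 <= m <= 3).
Proof.
have n_gt0 : 0 < n by lia.
have n_double : n = n %/ 2 + n %/ 2 by lia.
have h_even : ~~ odd (n %/ 2) by lia.
have h_ge4 : 4 <= n %/ 2 by lia.
have ge2 := has_unbounded_ham_cycle_ge2 n_gt0 n_double h_even h_ge4.
have P3 := has_unbounded_ham_cycle3 n_gt0 n_double h_even h_ge4.
(* Excluded middle chooses between 2 and 3 without settling which occurs for [8 < n]; the second
   case contradicts the explicit walk when [n = 8]. *)
case: (classic (has_unbounded_ham_cycle (@gp_adj n (n %/ 2)) 2)) => [P2|nP2].
  by exists 2.
exists 3; split; [split=> // k Pk | split=> // n8].
  by rewrite ltn_neqAle ge2 // andbT; apply/eqP => k2; subst k.
by case: nP2; rewrite n8 (_ : 8 %/ 2 = 4) //; apply: has_unbounded_ham_cycle2_8.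
Qed.
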